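(* Let $p\ge5$ be prime and let $A,B\in\mathbb{Z}$ with $p\mid A$ and $p\mid B$. For $k\ge1$ let $M_k$ be the number of $(x,y)\in(\mathbb{Z}/p^k\mathbb{Z})^2$ with $y^2\equiv x^3+Ax+B\pmod{p^k}$ and $x\equiv y\equiv 0\pmod p$. Let $\alpha=v_p(A)\ge1$ and $\beta=v_p(B)\ge1$ (possibly $\infty$). Exactly one of the following eight rows of conditions applies, each row having an associated integer $h$. In the row that applies, \[ M_1=1,\qquad M_k=p^k\quad(2\le k<h), \] and for every $k\ge h$ the value of $M_k$ is as follows. Row 1: $\beta=1$; $h=2$; $M_k=0$ for $k\ge h$. Row 2: $\alpha=1$, $\beta\ge2$; $h=2$; $M_k=p^k$ for $k\ge h$. Row 3: $\alpha\ge2$, $\beta=2$; $h=3$; $M_k=(1+\chi(B/p^2))\,p^k$ for $k\ge h$. Row 4: $\alpha\ge2$, $\beta\ge3$, and ($\alpha=2$ or $\beta=3$); $h=4$; $M_k=p^3K_{k-3}(A/p^2,B/p^3)$ for $k\ge h$. Row 5: $\alpha\ge3$, $\beta=4$; $h=5$; $M_k=(1+\chi(B/p^4))\,p^k$ for $k\ge h$. Row 6: $\alpha=3$, $\beta\ge5$; $h=5$; $M_k=p^k$ for $k\ge h$. Row 7: $\alpha\ge4$, $\beta=5$; $h=6$; $M_k=0$ for $k\ge h$. Row 8: $\alpha\ge4$, $\beta\ge6$; $h=6$; $M_k=p^7N_{k-6}(A/p^4,B/p^6)$ for $k\ge h$.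
   Context: $v_p$ is the $p$-adic valuation with $v_p(0)=\infty$. $\chi(u)=\left(\frac{u}{p}\right)$ is the Legendre symbol modulo $p$. For $a,b\in\mathbb{Z}$ and $j\ge1$, \[ N_j(a,b)=\#\{(x,y)\bmod p^j : y^2\equiv x^3+ax+b\pmod{p^j}\},\qquad N_0(a,b)=1. \] For $a,b\in\mathbb{Z}$ not both divisible by $p$ and $\ell\ge1$, \[ K_\ell(a,b)=\#\{(X,Y)\bmod p^\ell : X^3+aX+b\equiv pY^2\pmod{p^\ell}\},\qquad K_0=1. \] Here ''$(x,y)\bmod p^j$'' means both coordinates range over $\mathbb{Z}/p^j\mathbb{Z}$. *)

(* Defs.v *)
(* MathComp, with the extended integers \bar int of MathComp-Analysis. *)
From mathcomp Require Import all_boot all_order all_algebra.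
From mathcomp Require Import constructive_ereal.

Set Implicit Arguments.
Unset Strict Implicit.
Unset Printing Implicit Defensive.

Import Order.TTheory GRing.Theory Num.Theory.
Local Open Scope ring_scope.

Definition vp (p : nat) (z : int) : \bar int :=
  if z == 0 then +oo%E else ((logn p `|z|%N)%:Z)%:E.

(* The Legendre symbol (u / p), for p an odd prime. *)
Definition chi (p : nat) (u : int) : int :=
  if (p %| u)%Z then 0
  else if [exists x : 'I_p, (x%:Z ^+ 2 == u %[mod p])%Z] then 1 else -1.

(* In the three counts below Z/p^jZ is represented by the residues
   0, ..., p^j - 1, that is by 'I_(p ^ j). The type 'Z_(p ^ j) would be wrong
   for j = 0, where it has two elements. *)
Definition curveN (p j : nat) (a b : int) : nat :=
  #|[set xy : 'I_(p ^ j) * 'I_(p ^ j) |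
      (xy.2%:Z ^+ 2 == xy.1%:Z ^+ 3 + a * xy.1%:Z + b %[mod (p ^ j)%N])%Z]|.

(* Only meant for a and b not both divisible by p. *)
Definition curveK (p l : nat) (a b : int) : nat :=
  #|[set xy : 'I_(p ^ l) * 'I_(p ^ l) |
      (xy.1%:Z ^+ 3 + a * xy.1%:Z + b == p%:Z * xy.2%:Z ^+ 2
         %[mod (p ^ l)%N])%Z]|.

Definition curveM (p k : nat) (A B : int) : nat :=
  #|[set xy : 'I_(p ^ k) * 'I_(p ^ k) |
      [&& (xy.2%:Z ^+ 2 == xy.1%:Z ^+ 3 + A * xy.1%:Z + B %[mod (p ^ k)%N])%Z,
          (p %| xy.1)%N & (p %| xy.2)%N]]|.

Lemma curveN0 p a b : curveN p 0 a b = 1%N.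
Proof.
rewrite /curveN (_ : [set _ | _] = setT) ?cardsT ?card_prod ?card_ord //.
have modE m : (m %% (p ^ 0)%N)%Z = 0 by rewrite expn0 modz1.
by apply/setP=> xy; rewrite !inE !modE.
Qed.

Lemma curveK0 p a b : curveK p 0 a b = 1%N.
Proof.
rewrite /curveK (_ : [set _ | _] = setT) ?cardsT ?card_prod ?card_ord //.
have modE m : (m %% (p ^ 0)%N)%Z = 0 by rewrite expn0 modz1.
by apply/setP=> xy; rewrite !inE !modE.
Qed.

Inductive table_row := Row1 | Row2 | Row3 | Row4 | Row5 | Row6 | Row7 | Row8.

Definition row_applies (alpha beta : \bar int) (r : table_row) : bool :=
  match r with
  | Row1 => beta == 1%:E
  | Row2 => (alpha == 1%:E) && (2%:E <= beta)%E
  | Row3 => (2%:E <= alpha)%E && (beta == 2%:E)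
  | Row4 => [&& (2%:E <= alpha)%E, (3%:E <= beta)%E
              & (alpha == 2%:E) || (beta == 3%:E)]
  | Row5 => (3%:E <= alpha)%E && (beta == 4%:E)
  | Row6 => (alpha == 3%:E) && (5%:E <= beta)%E
  | Row7 => (4%:E <= alpha)%E && (beta == 5%:E)
  | Row8 => (4%:E <= alpha)%E && (6%:E <= beta)%E
  end.

Definition row_h (r : table_row) : nat :=
  match r with
  | Row1 => 2 | Row2 => 2 | Row3 => 3 | Row4 => 4
  | Row5 => 5 | Row6 => 5 | Row7 => 6 | Row8 => 6
  end.

(* Whenever row r applies, the quotients below are exact; whenever moreover
   row_h r <= k, the subtractions on indices are not truncated. *)
Definition row_value (p : nat) (A B : int) (r : table_row) (k : nat) : int :=
  match r with
  | Row1 => 0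
  | Row2 => p%:Z ^+ k
  | Row3 => (1 + chi p (B %/ p%:Z ^+ 2)%Z) * p%:Z ^+ k
  | Row4 => p%:Z ^+ 3
            * (curveK p (k - 3)%N (A %/ p%:Z ^+ 2)%Z (B %/ p%:Z ^+ 3)%Z)%:Z
  | Row5 => (1 + chi p (B %/ p%:Z ^+ 4)%Z) * p%:Z ^+ k
  | Row6 => p%:Z ^+ k
  | Row7 => 0
  | Row8 => p%:Z ^+ 7
            * (curveN p (k - 6)%N (A %/ p%:Z ^+ 4)%Z (B %/ p%:Z ^+ 6)%Z)%:Z
  end.

(* Main.v *)
(** Every count is of the form #{x mod p^n, y mod p^m : p^k | c y^2 - (d x^3 + a x + b)}.
    Starting from x = p x', y = p y', the equation is divided by p as often as
    possible; whenever it forces p | y (resp. p | x), that variable is replaced by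
    p y (resp. p x), and a variable ranging over more residues than the modulus can
    see contributes a factor p per superfluous digit. The process stops when a
    coefficient is a unit: a unit constant term with all other coefficients
    divisible by p leaves no solution, a unit linear coefficient in x (with p | d)
    makes the left side a bijection in x, and a unit c and b (with p | d, a) leaves
    1 + chi(b) values of y for each x. No general Hensel lemma is needed: if
    F(x) - F(y) is x - y times a unit, F permutes Z/p^k and has exactly one root. *)
Require Import Defs.
From mathcomp Require Import all_boot all_order all_algebra.
From mathcomp Require Import constructive_ereal ring zify.

Section Counting.
Local Open Scope ring_scope.
Import Order.TTheory GRing.Theory Num.Theory.

(** * Divisibility by [p] and sums over residues modulo powers of [p] *)

Lemma sum_ord_mul (m q : nat) (f : nat -> nat) :
  (\sum_(i < m * q) f i = \sum_(i < m) \sum_(r < q) f (r + i * q))%N.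
Proof.
rewrite -(big_mkord xpredT) big_nat_mul big_mkord; apply: eq_bigr => i _.
by rewrite -{1}[(i * q)%N]add0n big_addn mulSn addnK big_mkord.
Qed.

Variables (p : nat) (p_prime : prime p).

Let p_gt0 : (0 < p)%N := prime_gt0 p_prime.

Lemma primez_neq0 : p%:Z != 0.
Proof. by rewrite -lt0n. Qed.
Hint Resolve primez_neq0 : core.

Lemma PoszX (n : nat) : (p ^ n)%N%:Z = p%:Z ^+ n.
Proof. by elim: n => // n IHn; rewrite expnS PoszM IHn exprS. Qed.

Lemma Euclid_dvdzM (u v : int) : (p %| u * v)%Z = (p %| u)%Z || (p %| v)%Z.
Proof. by rewrite !dvdzE abszM Euclid_dvdM. Qed.

Lemma coprimez_prime_exp (k : nat) (u : int) :
  ~~ (p %| u)%Z -> coprimez (p%:Z ^+ k) u.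
Proof.
by move=> pu; apply/coprimezXl; rewrite coprimezE prime_coprime.
Qed.

Lemma dvdz_exp_prime (k : nat) (u : int) :
  (0 < k)%N -> (p%:Z ^+ k %| u)%Z -> (p %| u)%Z.
Proof. by move=> k0; apply: dvdz_trans; apply: dvdz_exp. Qed.

Lemma ord_ndvdz (r : 'I_p) : r != 0%N :> nat -> ~~ (p %| r%:Z)%Z.
Proof. by move=> r0; rewrite dvdzE !absz_nat gtnNdvd // lt0n. Qed.

(** Splits off the lowest base-[p] digit [r]; the periodic case below splits off the top digit
    instead, which [f] does not see. *)
Lemma sum_residues_digit (n : nat) (f : int -> nat) :
  (\sum_(i < p ^ n.+1) f i%:Z
     = \sum_(r < p) \sum_(i < p ^ n) f (r%:Z + p%:Z * i%:Z)%R)%N.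
Proof.
rewrite expnSr (sum_ord_mul _ _ (fun i => f i%:Z)) exchange_big /=.
by apply: eq_bigr => r _; apply: eq_bigr => i _; rewrite PoszD PoszM mulrC.
Qed.

Lemma sum_residues_periodic (n : nat) (f : int -> nat) :
    (forall x t, f (x + p%:Z ^+ n * t) = f x) ->
  (\sum_(i < p ^ n.+1) f i%:Z = p * \sum_(i < p ^ n) f i%:Z)%N.
Proof.
move=> fP; rewrite expnS (sum_ord_mul _ _ (fun i => f i%:Z)).
transitivity (\sum_(j < p) \sum_(i < p ^ n) f i%:Z)%N; last first.
  by rewrite sum_nat_const card_ord.
apply: eq_bigr => r _.
by apply: eq_bigr => i _; rewrite PoszD PoszM PoszX mulrC fP.
Qed.

Lemma sum_residues_multiples (n : nat) (f : int -> nat) :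
    (forall x, ~~ (p %| x)%Z -> f x = 0%N) ->
  (\sum_(i < p ^ n.+1) f i%:Z = \sum_(i < p ^ n) f (p%:Z * i%:Z)%R)%N.
Proof.
move=> f0; rewrite sum_residues_digit (bigD1 (Ordinal p_gt0)) //= [X in (_ + X)%N]big1.
  by rewrite addn0; apply: eq_bigr => i _; rewrite add0r.
move=> r r0; apply: big1 => i _; apply: f0.
by rewrite rpredDr ?dvdz_mulr //=; apply: ord_ndvdz.
Qed.

(** By hypothesis [F] induces an injective map of the finite set of residues modulo [p ^ k] to
    itself, hence a surjective one, so 0 is hit exactly once. *)
Lemma count_root_unique (k : nat) (F : int -> int) :
    (forall x y, (p%:Z ^+ k %| F x - F y) = (p%:Z ^+ k %| x - y))%Z ->
  (\sum_(i < p ^ k) (p%:Z ^+ k %| F i%:Z)%Z = 1)%N.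
Proof.
move=> FE; have q_gt0 : (0 < p ^ k)%N by rewrite expn_gt0 p_gt0.
have q0 : p%:Z ^+ k != 0 by rewrite expf_neq0.
have ltF x : (`|(F x %% p%:Z ^+ k)%Z| < p ^ k)%N.
  by rewrite -ltz_nat gez0_abs ?modz_ge0 // PoszX ltz_pmod // exprn_gt0.
have ordE (x y : 'I_(p ^ k)) : (p%:Z ^+ k %| x%:Z - y%:Z)%Z -> x = y.
  rewrite -eqz_mod_dvd -PoszX !modz_nat !modn_small ?ltn_ord // => /eqP[].
  exact: val_inj.
have Finj : injective (fun x : 'I_(p ^ k) => Ordinal (ltF x%:Z)).
  move=> x y /(congr1 val) /= /(congr1 Posz).
  rewrite !gez0_abs ?modz_ge0 // => /eqP; rewrite eqz_mod_dvd FE.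
  exact: ordE.
have /codomP[x0 /(congr1 val) /= /esym/eqP] := injF_onto Finj (Ordinal q_gt0).
rewrite absz_eq0 => /eqP/dvdz_mod0P Fx0.
rewrite (bigD1 x0) //= Fx0 big1 // => x; apply: contraNeq.
rewrite eqb0 negbK => Fx; apply/eqP/ordE.
by rewrite -FE rpredB.
Qed.

(** The second factor is prime to [p]. With [u] a difference of two arguments this supplies the
    hypothesis of [count_root_unique]. *)
Lemma dvdz_linear_factor (k : nat) (u v w : int) : ~~ (p %| v)%Z ->
  (p%:Z ^+ k %| u * (v + p%:Z * w))%Z = (p%:Z ^+ k %| u)%Z.
Proof.
move=> pv; apply/Gauss_dvdzl/coprimez_prime_exp.
by rewrite rpredDr // dvdz_mulr.
Qed.

(** * Square roots of a unit modulo powers of [p] *)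

Definition sqrt_count (n : nat) (u : int) : nat :=
  (\sum_(y < p ^ n) (p%:Z ^+ n %| (y%:Z ^+ 2 - u)%R)%Z)%N.

Lemma sqrt_count1 (u : int) : (2 < p)%N -> ~~ (p %| u)%Z ->
  (\sum_(r < p) (p %| (r%:Z ^+ 2 - u)%R)%Z)%N%:Z = 1 + chi p u.
Proof.
move=> p_gt2 pu; rewrite /chi (negPf pu).
case: existsP => [[x xu]|nx]; last first.
  by rewrite big1 // => r _; apply/eqP; rewrite eqb0; apply/negP;
     rewrite -eqz_mod_dvd => ru; apply: nx; exists r.
have x0 : x != 0%N :> nat.
  by apply: contraNneq pu => x0; move: xu; rewrite x0 eqz_mod_dvd expr0n sub0r rpredN.
have ltx : (p - x < p)%N by have := ltn_ord x; lia.
pose x' := Ordinal ltx.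
(* Equality would give [p = 2 * x]; since [p] is odd it would divide [x], a nonzero residue. *)
have x'x : x' != x.
  apply/eqP => /(congr1 val) /= px; have px2 : p = (2 * x)%N by have := ltn_ord x; lia.
  have := ord_ndvdz x x0; have: (p %| 2 * x)%N by rewrite -px2.
  by rewrite Euclid_dvdM // (gtnNdvd _ p_gt2) //= dvdzE => ->.
(* Modulo [p], [r ^ 2 - u] is [r ^ 2 - x ^ 2], a product of two linear factors, so the roots are [x]
   and [p - x]. *)
have rE (r : 'I_p) : (p %| r%:Z ^+ 2 - u)%Z = (r == x) || (r == x').
  have -> : (p %| r%:Z ^+ 2 - u)%Z = (p %| (r%:Z - x%:Z) * (r%:Z + x%:Z))%Z.
    rewrite -subr_sqr -[in LHS](subrKA (x%:Z ^+ 2)).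
    by rewrite rpredDr // -eqz_mod_dvd.
  rewrite Euclid_dvdzM; congr (_ || _).
    by rewrite -eqz_mod_dvd !modz_nat !modn_small ?ltn_ord.
  have -> : r%:Z + x%:Z = r%:Z - x'%:Z + p%:Z.
    by rewrite /= -subzn ?(ltnW (ltn_ord x)) //; ring.
  by rewrite rpredDr ?dvdzz // -eqz_mod_dvd !modz_nat !modn_small ?ltn_ord.
rewrite (bigD1 x) // (bigD1 x') // !rE !eqxx orbT /= big1 // => r /andP[rx rx'].
by rewrite rE (negPf rx) (negPf rx').
Qed.

(* On a residue class r with r^2 = u + s p, the equation y^2 = u becomes
   s + 2 r i + p i^2 = 0 for y = r + p i, with unit linear coefficient 2 r. *)
Lemma sqrt_countE (n : nat) (u : int) : (2 < p)%N -> (0 < n)%N ->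
  ~~ (p %| u)%Z -> (sqrt_count n u)%:Z = 1 + chi p u.
Proof.
case: n => // n p_gt2 _ pu; rewrite -sqrt_count1 //; congr Posz.
rewrite /sqrt_count (sum_residues_digit n (fun y => (_ %| y ^+ 2 - u)%Z : nat)).
apply: eq_bigr => r _.
have [/dvdzP[s us]|pru] := boolP (p %| r%:Z ^+ 2 - u)%Z; last first.
  apply: big1 => i _; apply/eqP; rewrite eqb0; apply: contra pru.
  move=> /dvdz_exp_prime => /(_ isT).
  rewrite (_ : _ - u = r%:Z ^+ 2 - u + p%:Z * (2 * r%:Z * i%:Z + p%:Z * i%:Z ^+ 2)); last by ring.
  by rewrite rpredDr // dvdz_mulr.
have pr : ~~ (p %| 2 * r%:Z)%Z.
  rewrite Euclid_dvdzM negb_or; apply/andP; split.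
    by rewrite dvdzE (gtnNdvd _ p_gt2).
  apply: contra pu => pr.
  rewrite (_ : u = r%:Z ^+ 2 - s * p%:Z) -?us; last by ring.
  by rewrite us rpredB ?dvdz_mull // dvdz_exp.
rewrite -[RHS](count_root_unique n (fun i => s + 2 * r%:Z * i + p%:Z * i ^+ 2)).
  apply: eq_bigr => i _; congr nat_of_bool.
  rewrite (_ : _ - u = p%:Z * (s + 2 * r%:Z * i%:Z + p%:Z * i%:Z ^+ 2)).
    by rewrite (exprS p%:Z) dvdz_mul2l.
  transitivity (r%:Z ^+ 2 - u + p%:Z * (2 * r%:Z * i%:Z + p%:Z * i%:Z ^+ 2)); first by ring.
  by rewrite us; ring.
move=> x y; rewrite -[RHS](dvdz_linear_factor _ _ (2 * r%:Z) (x + y)) //.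
by congr (_ %| _)%Z; ring.
Qed.

(** * The general count and its reduction moves *)

(* The ranges of x and y are independent of the modulus: substituting p x for x
   shortens the range of x only, dividing the equation by p lowers k only. *)
Definition sol_count (n m k : nat) (c d a b : int) : nat :=
  (\sum_(x < p ^ n) \sum_(y < p ^ m)
     (p%:Z ^+ k %| (c * y%:Z ^+ 2 - (d * x%:Z ^+ 3 + a * x%:Z + b))%R)%Z)%N.

Lemma sol_count_reduce_x (n m k : nat) (c d a b : int) : (k <= n)%N ->
  sol_count n.+1 m k c d a b = (p * sol_count n m k c d a b)%N.
Proof.
move=> kn; rewrite /sol_count.
rewrite (sum_residues_periodic n (fun x => \sum_(y < p ^ m)
  (_ %| (c * y%:Z ^+ 2 - (d * x ^+ 3 + a * x + b))%R)%Z)%N) // => x t.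
apply: eq_bigr => y _; congr nat_of_bool.
set z := p%:Z ^+ n * t.
have pz : (p%:Z ^+ k %| z)%Z by rewrite dvdz_mulr // dvdz_exp2l.
rewrite (_ : _ - _ = c * y%:Z ^+ 2 - (d * x ^+ 3 + a * x + b)
  + z * (- (d * (3 * x ^+ 2 + 3 * x * z + z ^+ 2) + a))); last by ring.
by rewrite rpredDr // dvdz_mulr.
Qed.

Lemma sol_count_reduce_y (n m k : nat) (c d a b : int) : (k <= m)%N ->
  sol_count n m.+1 k c d a b = (p * sol_count n m k c d a b)%N.
Proof.
move=> km; rewrite /sol_count big_distrr; apply: eq_bigr => x _.
rewrite (sum_residues_periodic m (fun y =>
  (_ %| c * y ^+ 2 - (d * x%:Z ^+ 3 + a * x%:Z + b))%Z : nat)) // => y t.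
congr nat_of_bool; set z := p%:Z ^+ m * t.
have pz : (p%:Z ^+ k %| z)%Z by rewrite dvdz_mulr // dvdz_exp2l.
rewrite (_ : _ - _ = c * y ^+ 2 - (d * x%:Z ^+ 3 + a * x%:Z + b)
  + z * (c * (2 * y + z))); last by ring.
by rewrite rpredDr // dvdz_mulr.
Qed.

(** Modulo [p] only the term [d x ^ 3] survives, and [d] is a unit, so every solution has [p]
    dividing [x]. *)
Lemma sol_count_mult_x (n m k : nat) (c d a b : int) : (0 < k)%N ->
    ~~ (p %| d)%Z -> (p %| c)%Z -> (p %| a)%Z -> (p %| b)%Z ->
  sol_count n.+1 m k c d a b = sol_count n m k c (p%:Z ^+ 3 * d) (p%:Z * a) b.
Proof.
move=> k0 pd pc pa pb; rewrite /sol_count.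
rewrite (sum_residues_multiples n (fun x => \sum_(y < p ^ m)
  (_ %| (c * y%:Z ^+ 2 - (d * x ^+ 3 + a * x + b))%R)%Z)%N).
  apply: eq_bigr => x _; apply: eq_bigr => y _; congr nat_of_bool.
  by congr (_ %| _)%Z; ring.
move=> x px; apply: big1 => y _; apply/eqP; rewrite eqb0.
apply: contra px => /(dvdz_exp_prime _ _ k0).
rewrite rpredDl ?dvdz_mulr // rpredN -addrA rpredDr.
  by rewrite Euclid_dvdzM (negPf pd) !exprS !Euclid_dvdzM expr0 dvdz1; lia.
by rewrite rpredD // dvdz_mulr.
Qed.

Lemma sol_count_mult_y (n m k : nat) (c d a b : int) : (0 < k)%N ->
    ~~ (p %| c)%Z -> (p %| d)%Z -> (p %| a)%Z -> (p %| b)%Z ->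
  sol_count n m.+1 k c d a b = sol_count n m k (p%:Z ^+ 2 * c) d a b.
Proof.
move=> k0 pc pd pa pb; rewrite /sol_count; apply: eq_bigr => x _.
rewrite (sum_residues_multiples m (fun y =>
  (_ %| c * y ^+ 2 - (d * x%:Z ^+ 3 + a * x%:Z + b))%Z : nat)).
  apply: eq_bigr => y _; congr nat_of_bool.
  by congr (_ %| _)%Z; ring.
move=> y py; apply/eqP; rewrite eqb0; apply: contra py => /(dvdz_exp_prime _ _ k0).
rewrite rpredBr; last by rewrite !rpredD // dvdz_mulr.
by rewrite !Euclid_dvdzM (negPf pc) /= orbb.
Qed.

(** The link between the coefficients is given by equations so that the quotients can be named when
    the lemma is applied and the matching left to [ring]. *)
Lemma sol_count_div (c d a b : int) (n m k : nat) (c' d' a' b' : int) :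
    c' = p%:Z * c -> d' = p%:Z * d -> a' = p%:Z * a -> b' = p%:Z * b ->
  sol_count n m k.+1 c' d' a' b' = sol_count n m k c d a b.
Proof.
move=> -> -> -> ->; apply: eq_bigr => x _; apply: eq_bigr => y _.
congr nat_of_bool; rewrite -[RHS](dvdz_mul2l primez_neq0) (exprS p%:Z).
by congr (_ %| _)%Z; ring.
Qed.

Lemma sol_count_mod1 (n m : nat) (c d a b : int) :
  sol_count n m 0 c d a b = (p ^ n * p ^ m)%N.
Proof.
rewrite /sol_count; under eq_bigr do under eq_bigr do rewrite expr0 dvd1z.
by under eq_bigr do rewrite sum_nat_const card_ord muln1; rewrite sum_nat_const card_ord.
Qed.

Lemma sol_count_eq0 (n m k : nat) (c d a b : int) : (0 < k)%N ->
    (p %| c)%Z -> (p %| d)%Z -> (p %| a)%Z -> ~~ (p %| b)%Z ->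
  sol_count n m k c d a b = 0%N.
Proof.
move=> k0 pc pd pa pb; apply: big1 => x _; apply: big1 => y _.
apply/eqP; rewrite eqb0; apply: contra pb => /(dvdz_exp_prime _ _ k0).
rewrite rpredDl ?dvdz_mulr // rpredN rpredDl //.
by rewrite rpredD // dvdz_mulr.
Qed.

Lemma sol_count_linear (m k : nat) (c d a b : int) :
    (p %| d)%Z -> ~~ (p %| a)%Z ->
  sol_count k m k c d a b = (p ^ m)%N.
Proof.
move=> /dvdzP[e ->] pa; rewrite /sol_count exchange_big /=.
transitivity (\sum_(y < p ^ m) 1)%N; last by rewrite sum_nat_const card_ord muln1.
apply: eq_bigr => y _.
apply: (count_root_unique k (fun x => c * y%:Z ^+ 2 - (e * p * x ^+ 3 + a * x + b))).
(* The difference of the two values is [x - x'] times [- a] plus a multiple of [p], which is a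
   unit. *)
move=> x x'; rewrite -[RHS](dvdz_linear_factor _ _ (- a)
  (- (e * (x ^+ 2 + x * x' + x' ^+ 2)))) ?rpredN //.
by congr (_ %| _)%Z; ring.
Qed.

(** For fixed [x] the equation reads [y ^ 2 = t + b] with [p] dividing [t], and [chi] depends only
    on the residue modulo [p]; each [x] thus contributes the same number of roots. *)
Lemma sol_count_square (n k : nat) (d a b : int) : (2 < p)%N -> (0 < k)%N ->
    (p %| d)%Z -> (p %| a)%Z -> ~~ (p %| b)%Z ->
  (sol_count n k k 1 d a b)%:Z = p%:Z ^+ n * (1 + chi p b).
Proof.
move=> p_gt2 k0 pd pa pb.
have chiE (t : int) : (p %| t)%Z -> chi p (t + b) = chi p b.
  move=> pt; rewrite /chi rpredDl //; case: ifP => // _.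
  have -> : ((t + b) %% p)%Z = (b %% p)%Z by apply/eqP; rewrite eqz_mod_dvd addrK.
  by [].
rewrite -PoszX -(sqrt_countE k) // -PoszM; congr Posz.
transitivity (\sum_(x < p ^ n) sqrt_count k b)%N; last first.
  by rewrite sum_nat_const card_ord.
apply: eq_bigr => x _.
set t := d * x%:Z ^+ 3 + a * x%:Z.
have pt : (p %| t)%Z by rewrite rpredD // dvdz_mulr.
transitivity (sqrt_count k (t + b)).
  by apply: eq_bigr => y _; rewrite mul1r.
by apply/eqP; rewrite -eqz_nat !sqrt_countE ?chiE // rpredDl.
Qed.

(** * The three counts of the theorem as instances of [sol_count] *)

Lemma card_set_pair (T1 T2 : finType) (P : T1 -> T2 -> bool) :
  #|[set xy | P xy.1 xy.2]| = (\sum_x \sum_y P x y)%N.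
Proof. by rewrite pair_bigA -sum1dep_card big_mkcond. Qed.

Lemma curveNE (k : nat) (a b : int) : curveN p k a b = sol_count k k k 1 1 a b.
Proof.
rewrite /curveN (card_set_pair _ _ (fun x y : 'I_(p ^ k) =>
  (y%:Z ^+ 2 == x%:Z ^+ 3 + a * x%:Z + b %[mod (p ^ k)%N])%Z)).
apply: eq_bigr => x _; apply: eq_bigr => y _; congr nat_of_bool.
by rewrite eqz_mod_dvd PoszX !mul1r.
Qed.

Lemma curveKE (k : nat) (a b : int) : curveK p k a b = sol_count k k k p 1 a b.
Proof.
rewrite /curveK (card_set_pair _ _ (fun x y : 'I_(p ^ k) =>
  (x%:Z ^+ 3 + a * x%:Z + b == p%:Z * y%:Z ^+ 2 %[mod (p ^ k)%N])%Z)).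
apply: eq_bigr => x _; apply: eq_bigr => y _; congr nat_of_bool.
by rewrite eq_sym eqz_mod_dvd PoszX mul1r.
Qed.

(** Substituting [p x] and [p y] absorbs the divisibility conditions. Each variable loses one digit,
    while the modulus keeps exponent [k.+1]. *)
Lemma curveME (k : nat) (a b : int) :
  curveM p k.+1 a b = sol_count k k k.+1 (p%:Z ^+ 2) (p%:Z ^+ 3) (p%:Z * a) b.
Proof.
rewrite /curveM (card_set_pair _ _ (fun x y : 'I_(p ^ k.+1) =>
  [&& (y%:Z ^+ 2 == x%:Z ^+ 3 + a * x%:Z + b %[mod (p ^ k.+1)%N])%Z,
      (p %| x)%N & (p %| y)%N])).
rewrite (sum_residues_multiples k (fun x => \sum_(y < p ^ k.+1)
  [&& (y%:Z ^+ 2 == x ^+ 3 + a * x + b %[mod (p ^ k.+1)%N])%Z,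
      (p %| x)%Z & (p %| y)%N])%N); last first.
  by move=> x /negPf px; apply: big1 => y _; rewrite px andbF.
apply: eq_bigr => x _; rewrite dvdz_mulr //=.
rewrite (sum_residues_multiples k (fun y =>
  (y ^+ 2 == (p%:Z * x%:Z) ^+ 3 + a * (p%:Z * x%:Z) + b %[mod (p ^ k.+1)%N])%Z
  && (p %| y)%Z : nat)); last by move=> y /negPf ->; rewrite andbF.
apply: eq_bigr => y _; congr nat_of_bool.
rewrite dvdz_mulr // andbT eqz_mod_dvd PoszX.
by congr (_ %| _)%Z; ring.
Qed.

(** * Successive divisions of the equation for [M_k] *)

Lemma prime_ndvdz1 : ~~ (p %| 1)%Z.
Proof. by rewrite dvdzE dvdn1 neq_ltn prime_gt1 ?orbT. Qed.
Hint Resolve prime_ndvdz1 : core.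

Lemma dvdz_prime_mul (u : int) : (p %| p%:Z * u)%Z.
Proof. exact: dvdz_mulr. Qed.
Hint Resolve dvdz_prime_mul : core.

Lemma curveM1 (a b : int) : (p %| b)%Z -> curveM p 1 a b = 1%N.
Proof.
move=> /dvdzP[c ->]; rewrite curveME.
rewrite (sol_count_div p (p%:Z ^+ 2) a c); [|ring..].
by rewrite sol_count_mod1.
Qed.

Lemma curveM_eq0 (k : nat) (a b : int) : (p %| a)%Z ->
  ~~ (p %| b)%Z -> curveM p k.+2 a (p%:Z * b) = 0%N.
Proof.
move=> pa pb; rewrite curveME.
rewrite (sol_count_div p (p%:Z ^+ 2) a b); [|ring..].
by rewrite sol_count_eq0 // dvdz_exp.
Qed.

(** After two divisions the modulus has exponent [k] while both variables have [k.+1] digits, whence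
    [p ^ 2]. *)
Lemma curveM_div2 (k : nat) (a b : int) :
  curveM p k.+2 (p%:Z * a) (p%:Z ^+ 2 * b) = (p ^ 2 * sol_count k k k 1 p a b)%N.
Proof.
rewrite curveME.
rewrite (sol_count_div p (p%:Z ^+ 2) (p%:Z * a) (p%:Z * b)); [|ring..].
rewrite (sol_count_div 1 p a b); [|ring..].
by rewrite sol_count_reduce_x // sol_count_reduce_y // mulnA.
Qed.

Lemma curveM_curveK (k : nat) (a b : int) :
  curveM p k.+3 (p%:Z ^+ 2 * a) (p%:Z ^+ 3 * b) = (p ^ 3 * curveK p k a b)%N.
Proof.
rewrite (_ : p%:Z ^+ 2 * a = p%:Z * (p%:Z * a)); last by ring.
rewrite (_ : p%:Z ^+ 3 * b = p%:Z ^+ 2 * (p%:Z * b)); last by ring.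
rewrite curveM_div2 sol_count_mult_y //.
rewrite (sol_count_div p 1 a b); [|ring..].
by rewrite sol_count_reduce_x // -curveKE mulnA -expnSr.
Qed.

Lemma curveK_div (k : nat) (a b : int) :
  curveK p k.+1 (p%:Z * a) (p%:Z * b)
    = (p * sol_count k k k 1 (p%:Z ^+ 2) (p%:Z * a) b)%N.
Proof.
rewrite curveKE sol_count_mult_x //.
rewrite (sol_count_div 1 (p%:Z ^+ 2) (p%:Z * a) b); [|ring..].
by rewrite sol_count_reduce_y.
Qed.

Lemma curveM_div4 (k : nat) (a b : int) :
  curveM p k.+4 (p%:Z ^+ 3 * a) (p%:Z ^+ 4 * b)
    = (p ^ 4 * sol_count k k k 1 (p%:Z ^+ 2) (p%:Z * a) b)%N.
Proof.
rewrite (_ : p%:Z ^+ 3 * a = p%:Z ^+ 2 * (p%:Z * a)); last by ring.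
rewrite (_ : p%:Z ^+ 4 * b = p%:Z ^+ 3 * (p%:Z * b)); last by ring.
rewrite curveM_curveK curveK_div.
by rewrite mulnA -expnSr.
Qed.

Lemma curveM_div5 (k : nat) (a b : int) :
  curveM p k.+4.+1 (p%:Z ^+ 3 * a) (p%:Z ^+ 5 * b)
    = (p ^ 5 * sol_count k k k p p a b)%N.
Proof.
rewrite (_ : p%:Z ^+ 5 * b = p%:Z ^+ 4 * (p%:Z * b)); last by ring.
rewrite curveM_div4 sol_count_mult_y ?dvdz_exp //.
rewrite (sol_count_div p p a b); [|ring..].
by rewrite sol_count_reduce_x // mulnA -expnSr.
Qed.

Lemma curveM_curveN (k : nat) (a b : int) :
  curveM p k.+4.+2 (p%:Z ^+ 4 * a) (p%:Z ^+ 6 * b) = (p ^ 7 * curveN p k a b)%N.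
Proof.
rewrite (_ : p%:Z ^+ 4 * a = p%:Z ^+ 3 * (p%:Z * a)); last by ring.
rewrite (_ : p%:Z ^+ 6 * b = p%:Z ^+ 5 * (p%:Z * b)); last by ring.
rewrite curveM_div5.
rewrite (sol_count_div 1 1 a b); [|ring..].
by rewrite sol_count_reduce_x // sol_count_reduce_y // -curveNE !mulnA -!expnSr.
Qed.

(** * Valuations as divisibility, and uniqueness of the row *)

Lemma le_vp (n : nat) (z : int) : (n%:Z%:E <= vp p z)%E = (p%:Z ^+ n %| z)%Z.
Proof.
rewrite /vp; case: eqVneq => [->|z0]; first by rewrite leey dvdz0.
by rewrite lee_fin lez_nat dvdzE -PoszX -pfactor_dvdn // absz_gt0.
Qed.

Lemma eq_vp (n : nat) (z : int) :
  (vp p z == n%:Z%:E) = (p%:Z ^+ n %| z)%Z && ~~ (p%:Z ^+ n.+1 %| z)%Z.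
Proof.
rewrite -!le_vp /vp; case: (eqVneq z 0) => [_|z0]; first by rewrite !leey.
by rewrite !lee_fin eqe eqz_nat !lez_nat -leqNgt eqn_leq andbC.
Qed.

Lemma row_appliesE (A B : int) (r : table_row) :
  row_applies (vp p A) (vp p B) r =
  let a n := (p%:Z ^+ n %| A)%Z in let b n := (p%:Z ^+ n %| B)%Z in
  match r with
  | Row1 => b 1%N && ~~ b 2%N
  | Row2 => a 1%N && ~~ a 2%N && b 2%N
  | Row3 => a 2%N && (b 2%N && ~~ b 3%N)
  | Row4 => [&& a 2%N, b 3%N & a 2%N && ~~ a 3%N || b 3%N && ~~ b 4%N]
  | Row5 => a 3%N && (b 4%N && ~~ b 5%N)
  | Row6 => a 3%N && ~~ a 4%N && b 5%N
  | Row7 => a 4%N && (b 5%N && ~~ b 6%N)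
  | Row8 => a 4%N && b 6%N
  end.
Proof. by case: r; rewrite /= -?eq_vp -?le_vp. Qed.

Lemma dvdz_expW (n : nat) (z : int) :
  (p%:Z ^+ n.+1 %| z)%Z -> (p%:Z ^+ n %| z)%Z.
Proof. by apply: dvdz_trans; apply: dvdz_exp2l. Qed.

Lemma dvdz_exp_factor (n : nat) (z : int) :
  (p%:Z ^+ n %| z)%Z -> exists u, z = p%:Z ^+ n * u.
Proof. by case/dvdzP=> u ->; exists u; rewrite mulrC. Qed.

Lemma dvdz_expS_factor (n : nat) (u : int) :
  (p%:Z ^+ n.+1 %| p%:Z ^+ n * u)%Z = (p %| u)%Z.
Proof. by rewrite exprSr dvdz_mul2l // expf_neq0. Qed.

Lemma row_unique (A B : int) : (p %| A)%Z -> (p %| B)%Z ->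
  exists! r : table_row, row_applies (vp p A) (vp p B) r.
Proof.
rewrite -[p%:Z]expr1 => pA pB.
suff [r rP r_uniq] : exists2 r, row_applies (vp p A) (vp p B) r
    & forall r', row_applies (vp p A) (vp p B) r' -> r = r' by exists r.
(* With divisibility by each power of [p] as a boolean, the claim is propositional; the [dvdz_expW]
   facts rule out truth assignments that are not monotone in the exponent. *)
move: (row_appliesE A B) (dvdz_expW 2 A) (dvdz_expW 3 A) (dvdz_expW 2 B)
  (dvdz_expW 3 B) (dvdz_expW 4 B) (dvdz_expW 5 B); rewrite /= pA pB.
case: (p%:Z ^+ 2 %| A)%Z; case: (p%:Z ^+ 3 %| A)%Z; case: (p%:Z ^+ 4 %| A)%Z;
case: (p%:Z ^+ 2 %| B)%Z; case: (p%:Z ^+ 3 %| B)%Z; case: (p%:Z ^+ 4 %| B)%Z;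
case: (p%:Z ^+ 5 %| B)%Z; case: (p%:Z ^+ 6 %| B)%Z => rowE;
do 6 (case/(_ isT) || move=> _) => //;
(* Backtracking tries each row until both its conditions and its uniqueness compute. *)
once ((exists Row1 + exists Row2 + exists Row3 + exists Row4
  + exists Row5 + exists Row6 + exists Row7 + exists Row8);
  [by rewrite rowE | by case; rewrite rowE]).
Qed.

(** * The values of [M_k] below and from [row_h] *)

Lemma curveM_lt_row_h (A B : int) (r : table_row) (k : nat) :
    row_applies (vp p A) (vp p B) r -> (p %| A)%Z ->
  (2 <= k < row_h r)%N -> curveM p k A B = (p ^ k)%N.
Proof.
rewrite row_appliesE /= => rP pA k_range.
(* [M2] to [M5] are the reductions above at [k = 0]: the remaining modulus is 1, so only the power
   of [p] is left. *)
have M2 : (p%:Z ^+ 2 %| B)%Z -> curveM p 2 A B = (p ^ 2)%N.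
  case/dvdz_exp_factor=> b ->; case/(dvdz_exp_factor 1): pA => a ->.
  by rewrite curveM_div2 sol_count_mod1 muln1.
have M3 : (p%:Z ^+ 2 %| A)%Z -> (p%:Z ^+ 3 %| B)%Z -> curveM p 3 A B = (p ^ 3)%N.
  move=> /dvdz_exp_factor[a ->] /dvdz_exp_factor[b ->].
  by rewrite curveM_curveK curveK0 muln1.
have M4 : (p%:Z ^+ 3 %| A)%Z -> (p%:Z ^+ 4 %| B)%Z -> curveM p 4 A B = (p ^ 4)%N.
  move=> /dvdz_exp_factor[a ->] /dvdz_exp_factor[b ->].
  by rewrite curveM_div4 sol_count_mod1 muln1.
have M5 : (p%:Z ^+ 3 %| A)%Z -> (p%:Z ^+ 5 %| B)%Z -> curveM p 5 A B = (p ^ 5)%N.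
  move=> /dvdz_exp_factor[a ->] /dvdz_exp_factor[b ->].
  by rewrite curveM_div5 sol_count_mod1 muln1.
move: rP (dvdz_expW 2 A) (dvdz_expW 3 A) (dvdz_expW 2 B)
  (dvdz_expW 3 B) (dvdz_expW 4 B) (dvdz_expW 5 B) k_range M2 M3 M4 M5.
move: k => [|[|[|[|[|[|k]]]]]]; rewrite ?andbF //; case: r => //=;
case: (p%:Z ^+ 2 %| A)%Z => //=; case: (p%:Z ^+ 3 %| A)%Z => //=;
case: (p%:Z ^+ 4 %| A)%Z => //=;
case: (p%:Z ^+ 2 %| B)%Z => //=; case: (p%:Z ^+ 3 %| B)%Z => //=;
case: (p%:Z ^+ 4 %| B)%Z => //=;
case: (p%:Z ^+ 5 %| B)%Z => //=; case: (p%:Z ^+ 6 %| B)%Z => //=; intuition.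
Qed.

Lemma curveM_ge_row_h (A B : int) (r : table_row) (k : nat) : (2 < p)%N ->
    row_applies (vp p A) (vp p B) r -> (p %| A)%Z -> (row_h r <= k)%N ->
  (curveM p k A B)%:Z = row_value p A B r k.
Proof.
(* Writing the index as [k + row_h r] brings it to the form of the reduction lemmas. *)
move=> p_gt2; rewrite row_appliesE /= => rP pA hk; rewrite -(subnK hk).
move: {hk}(k - _)%N => {}k.
have qK n u : ((p%:Z ^+ n * u) %/ p%:Z ^+ n)%Z = u by rewrite mulKz // expf_neq0.
case: r rP => /=.
- case/andP=> /(dvdz_exp_factor 1)[b ->]; rewrite dvdz_expS_factor => pb.
  by rewrite addn2 curveM_eq0.
- case/andP=> /andP[/(dvdz_exp_factor 1)[a ->]]; rewrite dvdz_expS_factor => pa.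
  case/dvdz_exp_factor=> b ->; rewrite addn2 curveM_div2 sol_count_linear //.
  by rewrite -expnD add2n PoszX.
- case/and3P=> /dvdz_exp_factor[a ->] /dvdz_exp_factor[b ->].
  rewrite dvdz_expS_factor => pb.
  rewrite qK addn3 exprS expr1 -mulrA curveM_div2 PoszM PoszX sol_count_square //.
  by rewrite mulrA -exprD mulrC.
- case/and3P=> /dvdz_exp_factor[a ->] /dvdz_exp_factor[b ->] _.
  by rewrite !qK addn4 !subSS subn0 curveM_curveK PoszM PoszX.
- case/and3P=> /dvdz_exp_factor[a ->] /dvdz_exp_factor[b ->].
  rewrite dvdz_expS_factor => pb.
  rewrite qK addnC curveM_div4 PoszM PoszX sol_count_square ?dvdz_exp //.
  by rewrite mulrA -exprD mulrC.
- case/andP=> /andP[/dvdz_exp_factor[a ->]]; rewrite dvdz_expS_factor => pa.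
  case/dvdz_exp_factor=> b ->; rewrite addnC curveM_div5 sol_count_linear //.
  by rewrite -expnD PoszX.
- case/and3P=> /dvdz_exp_factor[a ->] /dvdz_exp_factor[b ->].
  rewrite dvdz_expS_factor => pb.
  (* One factor [p] of [p ^ 4] stays in the linear coefficient, so after [curveM_div5] only the
     constant term is a unit. *)
  by rewrite (exprSr _ 3) -mulrA addnC curveM_div5 sol_count_eq0 ?dvdzz ?muln0.
- case/andP=> /dvdz_exp_factor[a ->] /dvdz_exp_factor[b ->].
  by rewrite !qK addnK addnC curveM_curveN PoszM PoszX.
Qed.

End Counting.

Theorem theorem13 (p : nat) (A B : int) (p_prime : prime p) (p_ge5 : 5 <= p)
    (pA : (p %| A)%Z) (pB : (p %| B)%Z) :
  (exists! r : table_row, row_applies (vp p A) (vp p B) r) /\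
  (forall r : table_row, row_applies (vp p A) (vp p B) r ->
     [/\ curveM p 1 A B = 1,
         forall k : nat, 2 <= k -> k < row_h r -> curveM p k A B = p ^ k
       & forall k : nat, row_h r <= k ->
           Posz (curveM p k A B) = row_value p A B r k]).
Proof.
split=> [|r rP]; first exact: row_unique.
split=> [|k k_ge2 k_lt|k k_ge]; first exact: curveM1.
  by apply: (@curveM_lt_row_h p p_prime A B r); rewrite // k_ge2.
by apply: curveM_ge_row_h; rewrite // (leq_trans _ p_ge5).
Qed.
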